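(* If $T$ is a tree of order $n\ge 4$ with a perfect matching, then $$\mathrm{aecc}_3(T)\ge \mathrm{aecc}_3(T_{n,n/2})=\begin{cases}3, & n=4,\\ \frac{9}{2}, & n=6,\\ \frac{11}{2}-\frac{2}{n}, & n\ge 8.\end{cases}$$
   Context: For a connected graph $G$ with $n(G)$ vertices and $S\subseteq V(G)$, the Steiner distance $d_G(S)$ is the minimum number of edges of a connected subgraph of $G$ containing $S$. For $v\in V(G)$, $\mathrm{ecc}_3(v,G)=\max\{d_G(S): v\in S\subseteq V(G), |S|=3\}$, and $\mathrm{aecc}_3(G)=\frac{1}{n(G)}\sum_{v\in V(G)}\mathrm{ecc}_3(v,G)$. For $m\ge 2$ and $m+1\le n\le 2m+1$, $T_{n,m}$ is the tree of order $n$ obtained from the star $K_{1,m}$ by choosing $n-m-1$ of its $m$ pendent vertices and attaching exactly one new pendent edge to each of them. (A tree with a perfect matching has even order.) *)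

(* Defs.v *)
From HB Require Import structures.
From mathcomp Require Import all_boot all_order all_algebra.

Set Implicit Arguments.
Unset Strict Implicit.
Unset Printing Implicit Defensive.

Record sgraph (V : finType) := SGraph {
  adj :> rel V;
  adj_sym : symmetric adj;
  adj_irr : irreflexive adj }.

Section Graphs.
Variables (V : finType) (G : sgraph V).

Definition edges : {set {set V}} :=
  [set [set p.1; p.2] | p : V * V & G p.1 p.2].

Definition connected : Prop := 0 < #|V| /\ forall x y : V, connect G x y.

(* A cycle of a simple graph has at least three vertices; [ucycle G [:: x; y]]
   also holds for every edge xy, hence the size condition. *)
Definition acyclic : Prop :=
  forall c : seq V, ucycle G c -> size c < 3.

Definition is_tree : Prop := connected /\ acyclic.

Definition perfect_matching (M : {set {set V}}) : bool :=
  (M \subset edges) && partition M [set: V].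

Definition has_perfect_matching : Prop :=
  exists M : {set {set V}}, perfect_matching M.

(* A subgraph is given by its vertex set H.1 and its edge set H.2. *)
Definition subgraph (H : {set V} * {set {set V}}) : bool :=
  (H.2 \subset edges) && [forall f in H.2, f \subset H.1].

Definition subgraph_connected (H : {set V} * {set {set V}}) : bool :=
  (H.1 != set0) &&
  [forall x in H.1, forall y in H.1,
    connect [rel u w | [set u; w] \in H.2] x y].

(* The default value #|edges| is harmless: in a connected graph, G itself is
   one of the subgraphs over which the minimum is taken (see
   connected_full_subgraph). *)
Definition steiner_dist (S : {set V}) : nat :=
  \big[minn/#|edges|]_(H : {set V} * {set {set V}}
      | [&& subgraph H, subgraph_connected H & S \subset H.1]) #|H.2|.

Definition ecc3 (v : V) : nat :=
  \max_(S : {set V} | (v \in S) && (#|S| == 3)) steiner_dist S.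

Definition aecc3 : rat :=
  ((\sum_(v : V) (ecc3 v)%:R) / #|V|%:R)%R.

Lemma in_edges (x y : V) : ([set x; y] \in edges) = G x y.
Proof.
apply/imsetP/idP => [[[a b]]|Gxy]; last by exists (x, y); rewrite ?inE.
rewrite inE /= => Gab /setP E.
have nab : a != b by apply: contraTneq Gab => ->; rewrite adj_irr.
have:= E a; have:= E b; rewrite !inE !eqxx orbT.
case/orP=> /eqP eb /orP[] /eqP ea; subst; rewrite ?eqxx // in nab *.
by rewrite adj_sym.
Qed.

Lemma connected_full_subgraph : connected ->
  subgraph ([set: V], edges) && subgraph_connected ([set: V], edges).
Proof.
move=> [V_gt0 conn]; rewrite /subgraph /subgraph_connected /= subxx /=.
apply/and3P; split; first by apply/forall_inP => f _; apply: subsetT.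
  by rewrite -card_gt0 cardsT.
apply/forall_inP => x _; apply/forall_inP => y _.
by rewrite (eq_connect (e' := G)) // => u w /=; rewrite in_edges.
Qed.

End Graphs.

(* The tree T_{n,m} on {0, ..., n-1}, meaningful for m + 1 <= n <= 2m + 1:
   0 is the centre of the star, 1, ..., m are its pendent vertices, and each
   remaining vertex j (m < j < n) is a new pendent vertex attached to j - m.
   The guard 0 < m in Tnm_adj only excludes loops in the irrelevant case m = 0. *)
Definition Tnm_arc (m i j : nat) : bool :=
  ((i == 0) && (0 < j <= m)) || ((m < j) && (i == j - m)).

Definition Tnm_adj (n m : nat) : rel 'I_n :=
  [rel i j : 'I_n | (0 < m) && (Tnm_arc m i j || Tnm_arc m j i)].

Lemma Tnm_adj_sym n m : symmetric (@Tnm_adj n m).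
Proof. by move=> i j; rewrite /Tnm_adj /= orbC. Qed.

Lemma Tnm_adj_irr n m : irreflexive (@Tnm_adj n m).
Proof.
move=> i; rewrite /Tnm_adj /Tnm_arc /= orbb; apply/negP.
case/andP=> m0 /orP[/andP[/eqP->]|/andP[lt_mi /eqP e]] //.
have: i - m < i by rewrite ltn_subrL m0 (leq_trans _ lt_mi).
by rewrite -e ltnn.
Qed.

Definition Tnm (n m : nat) : sgraph 'I_n :=
  SGraph (@Tnm_adj_sym n m) (@Tnm_adj_irr n m).

(* Main.v *)
(** The perfect matching gives a fixed-point-free involution [f] exchanging the
    ends of each matching edge; we study the contribution ecc3(v) + ecc3(f v) of
    each matching edge.  In a tree a non-backtracking walk is a geodesic, so two
    such walks issued from v along a common stem bound ecc3(v) from below by the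
    number of edges they cover together.  Exhibiting suitable walks shows that
    an edge contributes at least 9 when n >= 6, and at least 11 when n >= 8 and
    it is pendent with only one further neighbour.  If n >= 8 and an edge e
    contributes at most 10, then every other matching edge hangs on e and has
    no other neighbour, hence contributes at least 11.  So at most one edge
    contributes less than 11, and twice the sum of all eccentricities is at
    least 11 n - 4.  For T_{n,n/2}, the union of the paths to the centre bounds
    each eccentricity from above; since T_{n,n/2} is itself a tree with a
    perfect matching, the two bounds agree. *)
Require Import Defs.
From HB Require Import structures.
From mathcomp Require Import all_boot all_order all_algebra.
From mathcomp Require Import zify ring.

Set Implicit Arguments.
Unset Strict Implicit.
Unset Printing Implicit Defensive.

Import Order.TTheory GRing.Theory Num.Theory.

(** * Cuts, padding of finite sets, and minima *)

Lemma connect_cut (V : finType) (e : rel V) (A : {pred V}) (x y : V) :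
  connect e x y -> x \in A -> y \notin A ->
  exists u w, [/\ u \in A, w \notin A & e u w].
Proof.
case/connectP=> p ep ->; elim: p x ep => [|z p IH] x /=; first by move=> _ ->.
case/andP=> exz ep xA lA; case: (boolP (z \in A)) => zA; first exact: (IH z).
by exists x, z.
Qed.

Lemma superset_card (V : finType) (S : {set V}) (k : nat) :
  #|S| <= k <= #|V| -> exists2 S' : {set V}, S \subset S' & #|S'| = k.
Proof.
case/andP=> Sk; move: Sk; elim: k => [|k IH] Sk kV.
  by exists S => //; apply/eqP; rewrite -leqn0.
move: Sk; rewrite leq_eqVlt => /orP[/eqP|] Sk; first by exists S.
have [S' SS' cS'] := IH Sk (ltnW kV).
have /properP[_ [x _ xS']] : S' \proper [set: V].
  by rewrite properEcard subsetT cardsT cS'.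
by exists (x |: S'); rewrite ?cardsU1 ?xS' ?cS' // (subset_trans SS') ?subsetUr.
Qed.

Lemma bigmin_leq (I : eqType) (r : seq I) (P : pred I) (F : I -> nat) d i :
  i \in r -> P i -> \big[minn/d]_(j <- r | P j) F j <= F i.
Proof.
elim: r => // j r IH; rewrite inE big_cons => /orP[/eqP->|ir] Pi.
  by rewrite Pi geq_minl.
by case: ifP => _; rewrite ?geq_min IH ?orbT.
Qed.

(** * Branches and geodesics of a tree; lower bounds on Steiner distances *)

Section Steiner.
Variables (V : finType) (T : sgraph V).
Implicit Types (H : {set V} * {set {set V}}) (S : {set V}) (a b v x y z : V).

Lemma subgraph_cut H (A : {pred V}) x y :
    subgraph T H -> subgraph_connected H -> x \in H.1 -> y \in H.1 ->
    x \in A -> y \notin A ->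
  exists u w, [/\ u \in A, w \notin A, [set u; w] \in H.2,
    T u w & (u \in H.1) && (w \in H.1)].
Proof.
case/andP=> /subsetP sE /forall_inP sH /andP[_ /forall_inP cH] xH yH xA yA.
have /connect_cut/(_ xA yA) [u [w [uA wA /= uw]]] := forall_inP (cH x xH) y yH.
exists u, w; split=> //; first by rewrite -in_edges sE.
by have /subsetP s := sH _ uw; rewrite !s // !inE eqxx ?orbT.
Qed.

(** A vertex set is grown inside [H] one vertex at a time: connectedness gives an edge leaving the
    current set, and this edge has not been counted because only edges inside the set have been. *)
Lemma subgraph_connected_card H :
  subgraph T H -> subgraph_connected H -> #|H.1| <= #|H.2|.+1.
Proof.
move=> sH cH; have /andP[/set0Pn[r rH] _] := cH.
suff grow k : k < #|H.1| -> exists A : {set V}, [/\ A \subset H.1, r \in A,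
    #|A| = k.+1 & k <= #|[set f in H.2 | f \subset A]|].
  have H0 : 0 < #|H.1| by apply/card_gt0P; exists r.
  have [|A [_ _ _ hk]] := grow #|H.1|.-1; first by rewrite prednK.
  rewrite -(prednK H0) ltnS (leq_trans hk) // subset_leq_card //.
  by apply/subsetP => f; rewrite inE => /andP[].
elim: k => [|k IH] kH.
  by exists [set r]; rewrite sub1set rH inE eqxx cards1.
have [A [AH rA cA hk]] := IH (ltnW kH).
have /properP[_ [y yH yA]] : A \proper H.1 by rewrite properEcard AH cA.
have [u [w [uA wA uw _ /andP[_ wH]]]] := subgraph_cut sH cH rH yH rA yA.
exists (w |: A); split; rewrite ?inE ?rA ?orbT ?cardsU1 ?wA ?cA //.
  by rewrite subUset sub1set wH.
have fA : [set u; w] \notin [set f in H.2 | f \subset A].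
  by rewrite inE uw subUset !sub1set (negbTE wA) andbF.
have -> : k.+1 = k + 1 by rewrite addn1.
apply: leq_trans (leq_add hk (leqnn 1)) _; rewrite addn1.
rewrite -add1n -[1]/(true : nat) -fA -cardsU1 subset_leq_card //.
apply/subsetP => f; rewrite !inE => /orP[/eqP->|/andP[-> fA']] /=.
  by rewrite uw subUset !sub1set !inE uA eqxx orbT.
by rewrite (subset_trans fA') // subsetUr.
Qed.

Definition del_edge a b : rel V :=
  [rel x y | [&& T x y, (x != a) || (y != b) & (x != b) || (y != a)]].

(** The branch of the tree at [b]: the component of [b] once the edge [ab] is removed. *)
Definition side a b : {pred V} := [pred z | connect (del_edge a b) b z].

(** The walk starts at [x] and never reverses the step just made. This condition is local, hence
    checkable on explicit lists; acyclicity turns it into simplicity. *)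
Fixpoint nbwalk x (s : seq V) : bool :=
  if s is a :: s' then [&& T x a, ohead s' != Some x & nbwalk a s'] else true.

Lemma adj_neq x y : T x y -> x != y.
Proof. by apply: contraTneq => ->; rewrite adj_irr. Qed.

Lemma side_root a b : b \in side a b.
Proof. exact: connect0. Qed.

Hypothesis acT : acyclic T.

(** A simple path from [b] to [a] avoiding the edge would close up with that edge into a cycle. *)
Lemma side_far a b : T a b -> a \notin side a b.
Proof.
move=> Tab; apply/negP; rewrite inE /= => /connectP[p0 ep0 lp0].
case/shortenP: ep0 lp0 => p ep up _ lp {p0}.
have eT : subrel (del_edge a b) T by move=> x y /and3P[].
have cyc : ucycle T (b :: p).
  by apply/andP; split=> //; rewrite /= rcons_path (sub_path eT) // -lp.
have := acT cyc; case: p ep up lp cyc => [_ _ lp|z [|//] /=].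
  by move: Tab; rewrite lp adj_irr.
by rewrite /del_edge /= => /andP[/and3P[_ _]] + _ _ lp; rewrite lp !eqxx.
Qed.

Lemma side_cross a b u w : T a b ->
  u \in side a b -> w \notin side a b -> T u w -> u = b /\ w = a.
Proof.
move=> Tab us ws Tuw; case: (boolP (del_edge a b u w)) => [d|].
  by case/negP: ws; apply: connect_trans us (connect1 d).
rewrite /del_edge /= Tuw /= negb_and !negb_or !negbK.
case/orP=> /andP[/eqP eu /eqP ew] //; subst.
by case/negP: (side_far Tab).
Qed.

(** A path from [c] that avoids the edge [bc] could leave [side a b] only at [b], but [b] is not in
    [side b c]. *)
Lemma side_sub a b c : T a b -> T b c -> a != c ->
  {subset side b c <= side a b}.
Proof.
move=> Tab Tbc ac z; apply: contraTT => zab; apply/negP => zbc.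
have cab : c \in side a b.
  apply: connect1; rewrite /del_edge /= Tbc [c == a]eq_sym ac orbT.
  by rewrite eq_sym adj_neq.
have : z \notin [predI side a b & side b c] by rewrite inE /= (negbTE zab).
have : c \in [predI side a b & side b c] by rewrite inE /= cab side_root.
move=> cA zA; have [u [w [/andP[/= uab ubc] wn d]]] := connect_cut zbc cA zA.
have Tuw : T u w by case/and3P: d.
have wbc : w \in side b c := connect_trans ubc (connect1 d).
have [|eu _] := side_cross Tab uab _ Tuw.
  by apply: contra wn => wab; rewrite inE /= wab.
by move: ubc; rewrite eu (negbTE (side_far Tbc)).
Qed.

Lemma side_disjoint a b z : T a b -> z \in side a b -> z \notin side b a.
Proof.
move=> Tab zab; apply/negP => zba.
have : z \notin [predC side a b] by rewrite inE /= negbK.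
have : a \in [predC side a b] := side_far Tab.
move=> aA zA; have [u [w [/= us]]] := connect_cut zba aA zA.
rewrite inE negbK => ws /and3P[Tuw]; rewrite adj_sym in Tuw.
by have [-> ->] := side_cross Tab ws us Tuw; rewrite !eqxx orbF.
Qed.

(** By [side_sub], the branches at successive edges of the walk are nested. *)
Lemma nbwalk_side x a s :
  nbwalk x (a :: s) -> {subset a :: s <= side x a}.
Proof.
elim: s x a => [|b s IH] x a /=.
  by move=> _ z; rewrite inE => /eqP->; apply: side_root.
case/and3P=> Txa xb wk z; rewrite inE => /orP[/eqP->|zs]; first exact: side_root.
apply: (@side_sub x a b); rewrite ?(IH a b) //; last by rewrite eq_sym.
by case/and3P: wk.
Qed.

Lemma nbwalk_tail x a s : nbwalk x (a :: s) -> nbwalk a s.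
Proof. by case/and3P. Qed.

Lemma nbwalk_uniq x s : nbwalk x s -> uniq (x :: s).
Proof.
elim: s x => // a s IH x wk; rewrite cons_uniq (IH _ (nbwalk_tail wk)) andbT.
apply/negP => /(nbwalk_side wk); have /andP[Txa _] := wk.
exact/negP/side_far.
Qed.

Lemma nbwalk_catr x s t : nbwalk x (s ++ t) -> nbwalk (last x s) t.
Proof. by elim: s x => //= a s IH x /and3P[_ _ /IH]. Qed.

(** The end of the walk lies in [side x a] and [x] does not. As [xa] is the only edge leaving that
    branch, [H] must contain [a]; induction then follows the walk. *)
Lemma nbwalk_hull H x s :
    subgraph T H -> subgraph_connected H -> nbwalk x s ->
    x \in H.1 -> last x s \in H.1 -> {subset x :: s <= H.1}.
Proof.
move=> sH cH; elim: s x => [|a s IH] x wk xH lH z.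
  by rewrite inE => /eqP->.
rewrite inE => /orP[/eqP->//|]; apply: IH => //; first exact: nbwalk_tail wk.
have Txa : T x a by case/andP: wk.
have lS := nbwalk_side wk (mem_last a s).
have [u [w [us ws _ Tuw /andP[uH _]]]] :=
  subgraph_cut sH cH lH xH lS (side_far Txa).
by have [<- _] := side_cross Txa us ws Tuw.
Qed.

(** After the common stem [s], the two legs enter disjoint branches. Comparing [ohead] values lets
    one leg be empty, but not both. *)
Lemma tripod_uniq x s l1 l2 :
    nbwalk x (s ++ l1) -> nbwalk x (s ++ l2) -> ohead l1 != ohead l2 ->
  uniq (x :: s ++ l1 ++ l2).
Proof.
move=> w1 w2 h12; rewrite -cat_cons catA cat_uniq.
rewrite (nbwalk_uniq w1 : uniq ((x :: s) ++ l1)).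
have := nbwalk_uniq w2; rewrite -cat_cons cat_uniq => /and3P[_ n2 ->].
rewrite andbT; apply: contra n2 => /hasP[z z2]; rewrite mem_cat => /orP[zs|z1].
  by apply/hasP; exists z.
have {}w1 := nbwalk_catr w1; have {w2} := nbwalk_catr w2.
move: (last x s) => c in w1 *; case: l1 l2 z1 w1 h12 z2 => // a l1 [//|b l2].
move=> z1 w1 h12 z2 w2.
have /and3P[Tca _ _] := w1; have /and3P[Tcb _ _] := w2.
have za := nbwalk_side w1 z1; have zb := nbwalk_side w2 z2.
(* The branch [side a c] contains [side c b] and is disjoint from [side c a]. *)
have /negP[] := side_disjoint Tca za.
by apply: side_sub zb => //; rewrite adj_sym.
Qed.

Hypothesis cnT : connected T.

Lemma steiner_dist_ge S k :
    (forall H, subgraph T H -> subgraph_connected H -> S \subset H.1 ->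
      k <= #|H.2|) ->
  k <= steiner_dist T S.
Proof.
move=> hk; rewrite /steiner_dist.
elim/big_ind: _ => [|a b|H /and3P[]]; last exact: hk.
  have /andP[sH cH] := connected_full_subgraph cnT.
  by apply: (hk _ sH cH); apply: subsetT.
by rewrite leq_min => -> ->.
Qed.

(** A connected subgraph containing [x] and both ends contains both walks, which have one more
    distinct vertex than the claimed number of edges. *)
Lemma ecc3_tripod x s l1 l2 : 2 < #|V| ->
    nbwalk x (s ++ l1) -> nbwalk x (s ++ l2) -> ohead l1 != ohead l2 ->
  size s + size l1 + size l2 <= ecc3 T x.
Proof.
move=> V3 w1 w2 h12.
(* An empty leg may make two of these three vertices coincide, so the set is padded to size 3. *)
have [|S sS cS] := @superset_card _ [set x; last x (s ++ l1); last x (s ++ l2)] 3.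
  rewrite V3 andbT; apply: leq_trans (leq_card_setU _ _) _.
  by rewrite cards1 addn1 ltnS cards2; case: (_ != _).
have := sS; rewrite !subUset !sub1set => /andP[/andP[xS l1S] l2S].
apply: (@leq_trans (steiner_dist T S)); last first.
  by apply: leq_bigmax_cond; rewrite xS cS.
apply: steiner_dist_ge => H sH cH /subsetP SH.
rewrite -ltnS; apply: leq_trans (subgraph_connected_card sH cH).
have := tripod_uniq w1 w2 h12 => /card_uniqP; rewrite /= !size_cat addnA => <-.
apply: subset_leq_card; apply/subsetP => z.
have h1 := nbwalk_hull sH cH w1 (SH _ xS) (SH _ l1S).
have h2 := nbwalk_hull sH cH w2 (SH _ xS) (SH _ l2S).
rewrite inE !mem_cat => /or3P[/eqP->|zs|/orP[z1|z2]]; first exact: SH.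
- by apply: h1; rewrite inE mem_cat zs orbT.
- by apply: h1; rewrite inE mem_cat z1 !orbT.
- by apply: h2; rewrite inE mem_cat z2 !orbT.
Qed.

(** This supplies fresh vertices, together with their points of attachment, in the case analyses
    below. *)
Lemma adj_escape (s : seq V) x : size s < #|V| -> x \in s ->
  exists u w, [/\ u \in s, w \notin s & T u w].
Proof.
move=> sV xs; have [_ cn] := cnT.
have /subsetPn[y _ ys] : ~~ ([set: V] \subset s).
  apply/negP => /subset_leq_card; rewrite cardsT leqNgt => /negP[].
  exact: leq_ltn_trans (card_size s) sV.
exact: connect_cut (cn x y) xs ys.
Qed.
End Steiner.

(** * Contributions of matching edges, and lower bounds on the total *)

Section Matched.
Variables (V : finType) (T : sgraph V) (f : V -> V).
Hypotheses (acT : acyclic T) (cnT : connected T).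
Hypotheses (fT : forall x, T x (f x)) (fK : involutive f).
Implicit Types (v p q r s x : V).

Let F (v : V) : nat := ecc3 T v + ecc3 T (f v).

Lemma adj_mate x : T (f x) x.
Proof. by rewrite adj_sym. Qed.

Ltac hyp := first [assumption | rewrite eq_sym; assumption].

(** Distinctness of vertices is transported along the involution: [x != f y] amounts to
    [f x != y]. *)
Ltac neq := first
  [ hyp | rewrite (inv_eq fK); hyp | rewrite eq_sym (inv_eq fK); hyp
  | rewrite (inj_eq (inv_inj fK)); hyp ].

Ltac step := lazymatch goal with
  | |- is_true (Some ?a != Some ?b) => change (is_true (a != b)); neq
  | |- is_true (_ != _) => first [exact: isT | neq]
  | |- is_true true => exact: isT
  | |- _ => first [assumption | apply: fT | apply: adj_mate | rewrite adj_sym; assumption]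
  end.

Ltac walk := rewrite /=; repeat (apply/andP; split); step.

Lemma ecc3_ge_walks x (s l1 l2 : seq V) k :
    nbwalk T x (s ++ l1) -> nbwalk T x (s ++ l2) -> ohead l1 != ohead l2 ->
  2 < #|V| -> k <= size s + size l1 + size l2 -> k <= ecc3 T x.
Proof.
by move=> w1 w2 h V2 hk; apply: leq_trans hk _; apply: ecc3_tripod.
Qed.

Ltac ecc s l1 l2 := apply: (@ecc3_ge_walks _ s l1 l2);
  [walk | walk | walk | assumption | by []].

(** Walks from [f v] through [v] cover one edge more than their tails from [v]; a bound k at [v]
    thus gives k + 1 at [f v], and 2k + 1 in total. *)
Lemma pair_ge_walks (s : seq V) v (l1 l2 : seq V) k :
    nbwalk T (f v) (v :: s ++ l1) -> nbwalk T (f v) (v :: s ++ l2) ->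
    ohead l1 != ohead l2 -> 2 < #|V| ->
    k <= (size s + size l1 + size l2).*2.+1 -> k <= F v.
Proof.
move=> w1 w2 h V2 hk; apply: leq_trans hk _; rewrite /F -addnn -addnS leq_add //.
  by apply: ecc3_tripod => //; apply: nbwalk_tail; [exact: w1|exact: w2].
exact: (@ecc3_tripod _ T acT cnT _ (v :: s)).
Qed.

Ltac eccF s l1 l2 := apply: (@pair_ge_walks s _ l1 l2);
  [walk | walk | walk | assumption | by []].

Lemma ecc3_ge3 x : 3 < #|V| -> 2 < ecc3 T x.
Proof.
move=> V4; have V3 := ltnW V4; have [||u [w []]] := @adj_escape _ T cnT [:: x; f x] x.
- exact: V3.
- by rewrite inE eqxx.
rewrite !inE negb_or => /orP[]/eqP-> /andP[n1 n2] Tw.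
  by ecc (Nil V) [:: f x] [:: w; f w].
by ecc (Nil V) [:: f x; w; f w] (Nil V).
Qed.

Lemma ecc3_pairC v : F (f v) = F v.
Proof. by rewrite /F fK addnC. Qed.

(** The vertex [s] lengthens the leg through [p] to three edges. With a second leg through [r], five
    edges are covered from [v], giving 5 + 6; with one through [q], the ends [v] and [f v] see 6 and
    5 edges. *)
Lemma pair_ge11_branch v p s :
    2 < #|V| -> T v p -> p != f v ->
    (exists2 q, T (f v) q & q != v) \/ (exists r, [/\ T v r, r != f v & r != p]) ->
    [/\ T p s, s != v & s != f p] \/ T (f p) s /\ s != p ->
  10 < F v.
Proof.
move=> V3 Tp np; case=> [[q Tq nq]|[r [Tr nr rp]]] hs; last first.
  case: hs => [[Ts ns sp]|[Ts ns]].
    by eccF (Nil V) [:: p; s; f s] [:: r; f r].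
  by eccF (Nil V) [:: p; f p; s] [:: r; f r].
have h5 : 5 <= ecc3 T (f v) by ecc (Nil V) [:: v; p; f p] [:: q; f q].
suff h6 : 6 <= ecc3 T v by rewrite /F; lia.
case: hs => [[Ts ns sp]|[Ts ns]].
  by ecc (Nil V) [:: p; s; f s] [:: f v; q; f q].
by ecc (Nil V) [:: p; f p; s] [:: f v; q; f q].
Qed.

(* Both ends of the pendent edge see the same tripod: the walks from [f v] pass
   through [v], so it suffices to cover five edges from [v], which is found among
   [p], [f p], a pair [r], [f r] hanging on them, and a seventh vertex [x]. *)
Lemma pair_ge11_pendant v p :
    7 < #|V| -> T v p -> p != f v ->
    (forall s, T v s -> s = p \/ s = f v) -> (forall s, T (f v) s -> s = v) ->
  10 < F v.
Proof.
move=> V8 Tp np nbv nbfv; have V3 : 2 < #|V| by apply: leq_trans V8.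
have [||u [r []]] := @adj_escape _ T cnT [:: v; f v; p; f p] v.
- by rewrite /= (leq_trans _ V8).
- by rewrite inE eqxx.
rewrite !inE !negb_or => uA /and4P[rv rfv rp rfp] Tur.
have {uA} up : u = p \/ u = f p.
  case/or4P: uA Tur => /eqP-> Tr; [|by rewrite (nbfv _ Tr) eqxx in rv|by left|by right].
  by case: (nbv _ Tr) rp rfv => -> ; rewrite ?eqxx.
have [||w [x []]] := @adj_escape _ T cnT [:: v; f v; p; f p; r; f r] v.
- by rewrite /= (leq_trans _ V8).
- by rewrite inE eqxx.
rewrite !inE !negb_or => wA /andP[xv /andP[xfv /and4P[xp xfp xr xfr]]] Twx.
have {wA} wp : [|| w == p, w == f p, w == r | w == f r].
  case/or3P: wA Twx => [/eqP->|/eqP->|//] Tx; last by rewrite (nbfv _ Tx) eqxx in xv.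
  by case: (nbv _ Tx) xp xfv => -> ; rewrite ?eqxx.
(* The cases record where [r] and then [x] are attached; each tripod covers five edges from [v]. *)
case: up Tur => -> Tr; case/or4P: wp Twx => /eqP-> Tx.
- by eccF [:: p] [:: r; f r] [:: x; f x].
- by eccF [:: p] [:: r; f r] [:: f p; x].
- by eccF [:: p] [:: r; x; f x] [:: f p].
- by eccF [:: p] [:: r; f r; x] [:: f p].
- by eccF [:: p] [:: f p; r; f r] [:: x].
- by eccF [:: p; f p] [:: r; f r] [:: x].
- by eccF [:: p; f p; r] [:: f r] [:: x].
- by eccF [:: p; f p; r; f r] [:: x] (Nil V).
Qed.

Lemma pair_attached v : 2 < #|V| ->
  (exists2 p, T v p & p != f v) \/ (exists2 p, T (f v) p & p != v).
Proof.
move=> V3; have [||u [p []]] := @adj_escape _ T cnT [:: v; f v] v.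
- exact: V3.
- by rewrite inE eqxx.
rewrite !inE negb_or => /orP[]/eqP-> /andP[n1 n2] Tp.
  by left; exists p.
by right; exists p.
Qed.

Lemma second_attached v p :
  [\/ exists2 q, T (f v) q & q != v,
      exists r, [/\ T v r, r != f v & r != p]
    | (forall s, T v s -> s = p \/ s = f v) /\ (forall s, T (f v) s -> s = v)].
Proof.
case: (boolP [exists q, T (f v) q && (q != v)]) => [/existsP[q /andP[? ?]]|].
  by constructor 1; exists q.
rewrite negb_exists => /forallP nq.
case: (boolP [exists r, [&& T v r, r != f v & r != p]]) => [/existsP[r /and3P[? ? ?]]|].
  by constructor 2; exists r.
rewrite negb_exists => /forallP nr; constructor 3; split=> s Ts.
  by have := nr s; rewrite Ts /= negb_and !negbK => /orP[]/eqP; tauto.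
by apply/eqP; have := nq s; rewrite Ts /= negbK.
Qed.

Lemma pair_ge9 v : 5 < #|V| -> 8 < F v.
Proof.
move=> V6; have V3 : 2 < #|V| by apply: leq_trans V6.
(* Since [F] is symmetric under [f], the ends may be exchanged so that the further neighbour is at
   [v]. *)
wlog [p Tp np] : v / exists2 p, T v p & p != f v.
  move=> wl; case: (pair_attached v V3) => [|[p Tp np]]; first exact: wl.
  by rewrite -ecc3_pairC; apply: wl; exists p; rewrite ?fK.
case: (second_attached v p) => [[q Tq nq]|[r [Tr nr rp]]|[nbv nbfv]].
- have h1 : 5 <= ecc3 T v by ecc (Nil V) [:: p; f p] [:: f v; q; f q].
  have h2 : 5 <= ecc3 T (f v) by ecc (Nil V) [:: v; p; f p] [:: q; f q].
  by rewrite /F; lia.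
- by eccF (Nil V) [:: p; f p] [:: r; f r].
have [||u [r []]] := @adj_escape _ T cnT [:: v; f v; p; f p] v.
- by rewrite /= (leq_trans _ V6).
- by rewrite inE eqxx.
rewrite !inE !negb_or => uA /and4P[rv rfv rp rfp] Tur.
case/or4P: uA Tur => /eqP-> Tr.
- by case: (nbv _ Tr) rp rfv => -> ; rewrite ?eqxx.
- by rewrite (nbfv _ Tr) eqxx in rv.
- by eccF [:: p] [:: r; f r] [:: f p].
- by eccF [:: p; f p; r] [:: f r] (Nil V).
Qed.

(** Any further neighbour [s] of [p] or [f p] would yield 11 by [pair_ge11_branch], unless the edge
    of [v] is pendent with sole further neighbour [p], where [pair_ge11_pendant] applies. *)
Lemma light_pair_attached v p : 7 < #|V| -> F v <= 10 -> T v p -> p != f v ->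
  (forall s, T p s -> s = v \/ s = f p) /\ (forall s, T (f p) s -> s = p).
Proof.
move=> V8 Fv Tp np; have V3 : 2 < #|V| by apply: leq_trans V8.
have light s : ~ ([/\ T p s, s != v & s != f p] \/ T (f p) s /\ s != p).
  move=> hs; move: Fv; apply/negP; rewrite -ltnNge.
  case: (second_attached v p) => [h|h|[nbv nbfv]].
  - by apply: pair_ge11_branch hs => //; left.
  - by apply: pair_ge11_branch hs => //; right.
  - exact: pair_ge11_pendant nbv nbfv.
split=> s Ts.
  case: (eqVneq s v) => [|sv]; first by left.
  case: (eqVneq s (f p)) => [|sp]; first by right.
  by case: (light s); left.
by case: (eqVneq s p) => // sp; case: (light s); right.
Qed.

Lemma light_pair_unique v u :
  7 < #|V| -> F v <= 10 -> u != v -> u != f v -> 10 < F u.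
Proof.
move=> V8 Fv uv ufv.
have att x p : F x <= 10 -> T x p -> p != f x -> 10 < F p.
  move=> Fx Tp np; have [nbp nbfp] := light_pair_attached V8 Fx Tp np.
  apply: (pair_ge11_pendant V8 _ _ nbp nbfp); first by rewrite adj_sym.
  by neq.
have Ffv : F (f v) <= 10 by rewrite ecc3_pairC.
(* [A] consists of the light edge and the matching edges attached to it. The edges attached are
   pendent and contribute at least 11; [A] has no outgoing edge, so it is everything. *)
pose A := [pred z | [|| z == v, z == f v, T v z, T (f v) z, T v (f z) | T (f v) (f z)]].
case: (boolP (u \in A)) => [|uA].
  rewrite inE (negbTE uv) (negbTE ufv) /= => /or4P[] Tu.
  - exact: att Tu _.
  - by apply: att Tu _; rewrite ?fK.
  - by rewrite -ecc3_pairC; apply: att Tu _ => //; neq.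
  - by rewrite -ecc3_pairC; apply: att Tu _ => //; rewrite fK; neq.
have vA : v \in A by rewrite inE eqxx.
have [a [b [aA bA Tab]]] := connect_cut (cnT.2 v u) vA uA.
case/negP: bA; move: aA; rewrite !inE.
have nb x p : F x <= 10 -> T x p -> p != f x -> T p b -> b = x \/ b = f p.
  by move=> Fx Tp np; apply: (light_pair_attached V8 Fx Tp np).1.
have nbf x p : F x <= 10 -> T x (f p) -> f p != f x -> T p b -> b = f p.
  by move=> Fx Tp np Tb; apply: (light_pair_attached V8 Fx Tp np).2; rewrite fK.
case: (eqVneq a v) => [av _|nav]; first by rewrite -av Tab !orbT.
case: (eqVneq a (f v)) => [av _|nafv]; first by rewrite -av Tab !orbT.
move=> /= /or4P[] Ta.
- by case: (nb _ _ Fv Ta nafv Tab) => ->; rewrite ?eqxx // fK Ta !orbT.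
- by case: (nb _ _ Ffv Ta _ Tab) => [|->|->]; rewrite ?eqxx ?fK ?Ta ?orbT.
- by rewrite (nbf _ _ Fv Ta _ Tab) ?Ta ?orbT //; neq.
- by rewrite (nbf _ _ Ffv Ta _ Tab) ?Ta ?orbT // fK; neq.
Qed.

Lemma sum_pairs : \sum_v F v = (\sum_v ecc3 T v).*2.
Proof.
rewrite /F big_split -addnn; congr (_ + _).
by rewrite [RHS](reindex_inj (inv_inj fK)).
Qed.

Lemma sum_ecc3_ge4 : 3 < #|V| -> 3 * #|V| <= \sum_v ecc3 T v.
Proof.
move=> V4; rewrite mulnC -sum_nat_const; apply: leq_sum => v _.
exact: ecc3_ge3.
Qed.

Lemma sum_ecc3_ge6 : 5 < #|V| -> 9 * #|V| <= (\sum_v ecc3 T v).*2.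
Proof.
move=> V6; rewrite -sum_pairs mulnC -sum_nat_const; apply: leq_sum => v _.
exact: pair_ge9.
Qed.

Lemma sum_ecc3_ge8 : 7 < #|V| -> 11 * #|V| <= (\sum_v ecc3 T v).*2 + 4.
Proof.
move=> V8; rewrite -sum_pairs mulnC -sum_nat_const.
case: (boolP [exists v, F v <= 10]) => [/existsP[v Fv]|]; last first.
  rewrite negb_exists => /forallP FV; apply: leq_trans (leq_addr _ _).
  by apply: leq_sum => v _; rewrite ltnNge.
(* The exceptional edge lacks at most 11 - 9 = 2, and [F] counts it at both ends. *)
have s4 : \sum_u ((u == v) * 2 + (u == f v) * 2) = 4.
  have two x : \sum_u (u == x) * 2 = 2.
    by rewrite (bigD1 x) //= eqxx big1 // => i /negbTE->.
  by rewrite big_split /= !two.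
rewrite -[X in _ <= _ + X]s4 -big_split /=; apply: leq_sum => u _.
have u9 : 8 < F u by apply: pair_ge9; apply: leq_trans V8.
have := @light_pair_unique v u V8 Fv.
case: (eqVneq u v) => [-> _|_ /(_ isT)].
  rewrite (negbTE (adj_neq (fT v))) addn0; apply: (@leq_add 9 2) => //.
  by apply: pair_ge9; apply: leq_trans V8.
case: (u == f v) => [_|/(_ isT)]; last by rewrite !addn0.
by rewrite add0n; apply: (leq_add u9).
Qed.
End Matched.

(** * From a perfect matching to an involution *)

Lemma edge_card (V : finType) (T : sgraph V) (B : {set V}) :
  B \in edges T -> #|B| = 2.
Proof. by case/imsetP=> p; rewrite inE => /adj_neq np ->; rewrite cards2 np. Qed.

Lemma perfect_matching_even (V : finType) (T : sgraph V) :
  has_perfect_matching T -> ~~ odd #|V|.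
Proof.
case=> M /andP[/subsetP ME Mp].
rewrite -cardsT (card_uniform_partition (n := 2) _ Mp) ?oddM ?andbF //.
by move=> B /ME; apply: edge_card.
Qed.

Lemma perfect_matching_mate (V : finType) (T : sgraph V) :
  has_perfect_matching T ->
  exists f : V -> V, (forall x, T x (f x)) /\ involutive f.
Proof.
case=> M /andP[/subsetP ME /and3P[/eqP cM tM _]].
pose f x := odflt x [pick y | [set x; y] \in M].
have fM x : [set x; f x] \in M.
  rewrite /f; case: pickP => //= none.
  have : x \in cover M by rewrite cM.
  case/bigcupP=> B BM xB; have /imsetP[[a b]] := ME _ BM; rewrite inE /= => Tab eB.
  move: xB; rewrite eB !inE => /orP[]/eqP ex; subst.
    by have := none b; rewrite BM.
  by have := none a; rewrite setUC BM.
have fT x : T x (f x) by rewrite -in_edges ME.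
exists f; split=> // x.
(* Both blocks contain [f x], so disjointness of distinct blocks makes them equal. *)
have e : [set x; f x] = [set f x; f (f x)].
  apply/eqP; apply: contraT => ne.
  have /trivIsetP/(_ _ _ (fM x) (fM (f x)) ne) := tM.
  by move/disjoint_setI0/setP/(_ (f x)); rewrite !inE eqxx orbT.
have : f (f x) \in [set x; f x] by rewrite e !inE eqxx orbT.
by rewrite !inE => /orP[/eqP//|]; rewrite eq_sym (negbTE (adj_neq (fT _))).
Qed.

(** * The extremal tree: structure and upper bounds *)

Section Spider.
Variable m : nat.
Hypothesis m2 : 1 < m.
Local Notation n := (m.*2).
Let G := Tnm n m.

Lemma root_subproof : 0 < n. Proof. lia. Qed.
Definition root_ord : 'I_n := Ordinal root_subproof.
Local Notation root := root_ord.

(** The tree is rooted at the centre 0, which is its own parent. *)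
Definition parent_nat (i : nat) := if i <= m then 0 else i - m.

Lemma parent_subproof (i : 'I_n) : parent_nat i < n.
Proof. by have := ltn_ord i; rewrite /parent_nat; case: ifP; lia. Qed.
Definition parent (i : 'I_n) : 'I_n := Ordinal (parent_subproof i).

Lemma adj_parent (i : 'I_n) : i != root -> G i (parent i).
Proof.
rewrite -val_eqE /= /Tnm_adj /Tnm_arc /= /parent_nat.
by case: (leqP i m); lia.
Qed.

Lemma adj_lt_parent (i j : 'I_n) : G i j -> j < i -> j = parent i.
Proof.
rewrite /= /Tnm_adj /Tnm_arc /= => Gij ji; apply: val_inj => /=.
by rewrite /parent_nat; case: (leqP i m); lia.
Qed.

Lemma parent_parent (i : 'I_n) : parent (parent i) = root.
Proof.
apply: val_inj => /=; rewrite /parent_nat; have := ltn_ord i.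
by case: (leqP i m) => //= *; rewrite ifT //; lia.
Qed.

Lemma spider_connected : connected G.
Proof.
split; first by rewrite card_ord root_subproof.
have toroot (x : 'I_n) : connect G x root.
  have step (y : 'I_n) : connect G y (parent y).
    case: (eqVneq y root) => [->|yr]; last exact: connect1 (adj_parent yr).
    by rewrite (_ : parent root = root) ?connect0 //; apply: val_inj.
  by rewrite -(parent_parent x); apply: connect_trans (step _) (step _).
move=> x y; apply: connect_trans (toroot x) _.
by rewrite (sym_connect_sym (@adj_sym _ G)).
Qed.

(** The largest label on a cycle would have two distinct smaller neighbours there, but its only
    smaller neighbour is its parent. *)
Lemma spider_acyclic : acyclic G.
Proof.
move=> c /andP[cc uc]; rewrite ltnNge; apply/negP => c3.
have [x0 x0c] : exists x, x \in c.
  by case: c c3 {cc uc} => // x c _; exists x; rewrite mem_head.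
case: (@arg_maxnP _ x0 (mem c) (@nat_of_ord n) x0c) => j jc jmax.
have [i c' ec] := rot_to jc.
have c'c z : z \in c' -> z \in c by move=> zc; rewrite -(mem_rot i) ec inE zc orbT.
have : cycle G (j :: c') by rewrite -ec rot_cycle.
have : uniq (j :: c') by rewrite -ec rot_uniq.
have : 2 < size (j :: c') by rewrite -ec size_rot.
have lt_j z : z \in c' -> j \notin c' -> z < j.
  move=> zc jc'; have zj : z <= j := jmax z (c'c z zc).
  rewrite ltn_neqAle zj andbT.
  by apply: contraNneq jc' => /val_inj <-.
case: c' c'c lt_j {ec} => // a c' _; case/lastP: c' => // c' b lt_j _.
move=> /andP[jn /andP[ab _]].
rewrite /= rcons_path last_rcons => /andP[Gja /andP[_ Gbj]].
have aj := adj_lt_parent Gja (lt_j a (mem_head _ _) jn).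
have Gjb : G j b by rewrite adj_sym.
have bc : b \in a :: rcons c' b by rewrite inE mem_rcons mem_head orbT.
have bj := adj_lt_parent Gjb (lt_j b bc jn).
by move: ab; rewrite aj -bj mem_rcons mem_head.
Qed.

Lemma mate_subproof (i : 'I_n) : (if i < m then i + m else i - m) < n.
Proof. by have := ltn_ord i; case: (ltnP i m); lia. Qed.
(** The centre is matched with [m], the one pendent vertex of the star that receives no new edge;
    every other leg is matched with itself. *)
Definition spider_mate (i : 'I_n) : 'I_n := Ordinal (mate_subproof i).

Lemma spider_mateK : involutive spider_mate.
Proof.
move=> i; apply: val_inj => /=; have := ltn_ord i.
by case: (ltnP i m) => *; case: ifP; lia.
Qed.

Lemma adj_spider_mate i : G i (spider_mate i).
Proof.
rewrite /= /Tnm_adj /Tnm_arc /=; have := ltn_ord i.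
by case: (ltnP i m); lia.
Qed.

(** The paths from [S] to the centre form a connected subgraph with one edge, to the parent, for
    each vertex other than the centre. *)
Lemma steiner_dist_spider (S : {set 'I_n}) :
  steiner_dist G S <= #|(S :|: parent @: S) :\ root|.
Proof.
pose U := (S :|: parent @: S) :\ root.
pose H := (root |: U, [set [set i; parent i] | i in U]).
have UH i : i \in U -> (i \in H.1) && (parent i \in H.1).
  move=> iU; rewrite /H /= in_setU1 iU orbT in_setU1 /=.
  case: (eqVneq (parent i) root) => //= pr; rewrite !inE pr.
  move: iU; rewrite !inE => /andP[_ /orP[iS|/imsetP[k _ ek]]].
    by rewrite imset_f ?orbT.
  by rewrite ek parent_parent eqxx in pr.
apply: (@leq_trans #|H.2|); last exact: leq_imset_card.
apply: bigmin_leq; first by rewrite mem_index_enum.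
apply/and3P; split.
- apply/andP; split.
    apply/subsetP => _ /imsetP[i iU ->].
    by rewrite in_edges adj_parent //; move: iU; rewrite !inE => /andP[].
  apply/forall_inP => _ /imsetP[i iU ->].
  by rewrite subUset !sub1set UH.
- apply/andP; split; first by apply/set0Pn; exists root; rewrite !inE eqxx.
  set e := [rel u w | [set u; w] \in H.2].
  have es : connect_sym e by apply: sym_connect_sym => x y; rewrite /= setUC.
  have step x : x \in H.1 -> connect e x (parent x).
    rewrite /H /= in_setU1 => /orP[/eqP->|xU].
      by rewrite (_ : parent root = root) ?connect0 //; apply: val_inj.
    by apply: connect1; apply: imset_f.
  have toroot x : x \in H.1 -> connect e x root.
    move=> xH; case: (eqVneq x root) => [->|xr]; first exact: connect0.
    have xU : x \in U by move: xH; rewrite /H /= in_setU1 (negbTE xr).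
    rewrite -(parent_parent x); apply: connect_trans (step _ xH) (step _ _).
    by have /andP[] := UH _ xU.
  apply/forall_inP => x xH; apply/forall_inP => y yH.
  by apply: connect_trans (toroot x xH) _; rewrite es toroot.
by apply/subsetP => x xS; rewrite /H /= !inE xS andbT; case: (x == root).
Qed.

Lemma ecc3_spider_sup (i : 'I_n) k :
    (forall S : {set 'I_n}, i \in S -> #|S| = 3 ->
      #|(S :|: parent @: S) :\ root| <= k) ->
  ecc3 G i <= k.
Proof.
move=> hk; apply/bigmax_leqP => S /andP[iS /eqP cS].
exact: leq_trans (steiner_dist_spider S) (hk S iS cS).
Qed.

Lemma ecc3_spider_order (i : 'I_n) : ecc3 G i <= n.-1.
Proof.
apply: ecc3_spider_sup => S _ _; rewrite -[n in n.-1]card_ord -(cardC1 root).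
by apply: subset_leq_card; apply/subsetP => j; rewrite !inE => /andP[].
Qed.

(** Each vertex costs at most its depth, [(0 < i) + (m < i)] for [i]; the other two have depth at
    most 2. *)
Lemma ecc3_spider_depth (i : 'I_n) : ecc3 G i <= (0 < i) + (m < i) + 4.
Proof.
apply: ecc3_spider_sup => S iS cS.
have cardP (P : pred 'I_n) : #|[set j in S | P j]| = \sum_(j in S) P j.
  have -> : \sum_(j in S) P j = \sum_(j in S | P j) 1.
    by rewrite big_mkcondr; apply: eq_bigr => j _; case: (P j).
  by rewrite -sum1_card; apply: eq_bigl => j; rewrite inE.
apply: (@leq_trans (\sum_(j in S) ((0 < j) + (m < j)))).
  rewrite big_split /= -!cardP.
  apply: (@leq_trans #|[set j in S | 0 < j] :|: parent @: [set j in S | m < j]|).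
    apply: subset_leq_card; apply/subsetP => j; rewrite !inE -val_eqE /= -lt0n.
    case/andP=> j0 /orP[->|/imsetP[k kS ejk]]; first by rewrite j0.
    apply/orP; right; apply/imsetP; exists k => //; rewrite inE kS.
    by move: j0; rewrite ejk /= /parent_nat; case: (leqP k m).
  by apply: leq_trans (leq_card_setU _ _) _; rewrite leq_add2l leq_imset_card.
rewrite (big_setD1 i) //= leq_add2l.
have c2 : #|S :\ i| = 2 by have := cardsD1 i S; rewrite iS cS => -[].
rewrite -[4]/(2 * 2) -[X in _ <= X * _]c2 -sum_nat_const.
by apply: leq_sum => j _; case: (0 < j); case: (m < j).
Qed.
End Spider.

(** * Exact totals for the extremal tree *)

Lemma sum_ord_gt n k : \sum_(i < n) (k < i) = n - k.+1.
Proof.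
elim: n => [|n IH]; first by rewrite big_ord0.
by rewrite big_ord_recr /= IH; case: ltnP; lia.
Qed.

Lemma sum_ecc3_spider_le m : 1 < m ->
  (\sum_i ecc3 (Tnm m.*2 m) i).*2 + 4 <= 11 * m.*2.
Proof.
move=> m2.
have : \sum_i ecc3 (Tnm m.*2 m) i <= \sum_(i < m.*2) ((0 < i) + (m < i) + 4).
  by apply: leq_sum => i _; apply: ecc3_spider_depth.
rewrite 2!big_split /= !sum_ord_gt sum_nat_const card_ord; lia.
Qed.

Lemma sum_ecc3_spider2 : \sum_i ecc3 (Tnm 4 2) i <= 12.
Proof.
have -> : 12 = \sum_(i < 4) 3 by rewrite sum_nat_const card_ord.
by apply: leq_sum => i _; apply: (@ecc3_spider_order 2 isT i).
Qed.

Lemma sum_ecc3_spider3 : \sum_i ecc3 (Tnm 6 3) i <= 27.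
Proof.
(* The depth bound is too weak for labels 1 and 2. Needing all five edges would force the leaves 3,
   4, 5 into [S], besides [i]: four vertices. *)
suff le4 (i : 'I_6) : ecc3 (Tnm 6 3) i <= 4 + (2 < i).
  have -> : 27 = \sum_(i < 6) (4 + (2 < i)).
    by rewrite big_split /= sum_ord_gt sum_nat_const card_ord.
  by apply: leq_sum => i _; apply: le4.
case: (ltnP 2 i) => i3; first exact: (@ecc3_spider_order 3 isT i).
case: (posnP i) => [i0|i0].
  by apply: leq_trans (@ecc3_spider_depth 3 isT i) _; rewrite i0.
apply: (@ecc3_spider_sup 3 isT) => S iS cS; rewrite leqNgt; apply/negP => c5.
set U := _ :\ _ in c5.
have outer (j : 'I_6) : 2 < j -> j \in S.
  move=> j3; have : j \in U.
    apply: contraT => jU; move: c5; rewrite ltnNge => /negP[].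
    have c2 : #|[set root_ord (isT : 1 < 3); j]| = 2.
      by rewrite cards2 -val_eqE /= eq_sym -lt0n (leq_trans _ j3).
    have := cardsC [set root_ord (isT : 1 < 3); j]; rewrite c2 card_ord => c4.
    apply: (@leq_trans #|~: [set root_ord (isT : 1 < 3); j]|); last by lia.
    apply: subset_leq_card; apply/subsetP => k kU; rewrite !inE negb_or.
    by apply/andP; split; apply: contraTneq kU => ->; rewrite // !inE eqxx.
  rewrite !inE => /andP[_ /orP[//|/imsetP[k _ ej]]].
  move: j3; rewrite ej /= /parent_nat; have := ltn_ord k.
  by case: (leqP k 3); lia.
have : uniq [:: i; inord 3; inord 4; inord 5].
  rewrite /= !inE -!val_eqE /= !inordK //; lia.
move/card_uniqP => /= c4.
have : 4 <= #|S|; last by rewrite cS.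
rewrite -c4; apply: subset_leq_card; apply/subsetP => j.
by rewrite !inE => /or4P[]/eqP-> //; apply: outer; rewrite inordK.
Qed.

(** Division by the order 2m turns these values into 3, 9/2 and 11/2 - 2/n. *)
Definition min_total_ecc3 (m : nat) : nat :=
  if m == 2 then 12 else if m == 3 then 27 else 11 * m - 2.

Lemma sum_ecc3_ge (V : finType) (T : sgraph V) (f : V -> V) (m : nat) :
    acyclic T -> connected T -> (forall x, T x (f x)) -> involutive f ->
    1 < m -> #|V| = m.*2 ->
  min_total_ecc3 m <= \sum_v ecc3 T v.
Proof.
move=> aT cT fT fK m2 cV; rewrite /min_total_ecc3.
have := sum_ecc3_ge4 aT cT fT fK; have := sum_ecc3_ge6 aT cT fT fK.
have := sum_ecc3_ge8 aT cT fT fK; rewrite cV.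
by case: eqP => [->|?]; [|case: eqP => [->|?]]; lia.
Qed.

Lemma sum_ecc3_spider (m : nat) : 1 < m ->
  \sum_i ecc3 (Tnm m.*2 m) i = min_total_ecc3 m.
Proof.
move=> m2; apply/eqP; rewrite eqn_leq (sum_ecc3_ge (spider_acyclic m2)
  (spider_connected m2) (adj_spider_mate m2) (spider_mateK m2)) ?card_ord //.
rewrite andbT /min_total_ecc3; case: eqP => [->|_]; first exact: sum_ecc3_spider2.
case: eqP => [->|_]; first exact: sum_ecc3_spider3.
by have := sum_ecc3_spider_le m2; lia.
Qed.

(** * Passage to rational averages *)

Local Open Scope ring_scope.

Lemma aecc3E (V : finType) (T : sgraph V) :
  aecc3 T = (\sum_v ecc3 T v)%:R / #|V|%:R.
Proof. by rewrite natr_sum. Qed.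

Theorem corollary5p5 (V : finType) (T : sgraph V) (n : nat)
    (hn : #|V| = n) (hn4 : (4 <= n)%N)
    (hT : is_tree T) (hM : has_perfect_matching T) :
  aecc3 T >= aecc3 (Tnm n n./2) /\
  [/\ n = 4%N -> aecc3 (Tnm n n./2) = 3,
      n = 6%N -> aecc3 (Tnm n n./2) = 9 / 2
    & (8 <= n)%N -> aecc3 (Tnm n n./2) = 11 / 2 - 2 / n%:R].
Proof.
have [f [fT fK]] := perfect_matching_mate hM.
have [cT aT] := hT.
have ev : ~~ odd n by rewrite -hn; apply: perfect_matching_even hM.
have [m en] : exists m, n = m.*2 by exists n./2; rewrite even_halfK.
move: hn hn4; rewrite {}en {ev n} doubleK => hn hn4.
have m2 : (1 < m)%N by lia.
have n_gt0 : 0 < m.*2%:R :> rat by rewrite ltr0n; lia.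
(* Both averages have the same denominator, so only the integer totals are compared. *)
rewrite !aecc3E hn card_ord sum_ecc3_spider //; split.
  by rewrite ler_pM2r ?invr_gt0 // ler_nat; apply: sum_ecc3_ge aT cT fT fK m2 hn.
rewrite /min_total_ecc3; split=> em.
- have -> : m = 2%N by lia.
  by [].
- have -> : m = 3%N by lia.
  by [].
rewrite !ifN; [|lia|lia].
apply: (mulIf (lt0r_neq0 n_gt0)); rewrite mulfVK ?lt0r_neq0 // mulrBl.
rewrite mulfVK ?lt0r_neq0 //.
rewrite natrB; last by lia.
by rewrite -mul2n !natrM; field.
Qed.
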